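(* Let $L$ be a continuous lattice. The following conditions are equivalent: (1) $\sigma(L^{op})=\upsilon(L^{op})$. (2) The bi-Scott topology $\sigma_{Bi}(L)=\sigma(L)\vee\sigma(L^{op})$ on $L$ is compact and Hausdorff. (3) $\sigma(L^{op})\cong Q(L)$ (order isomorphism), where $Q(L)$ is the set of compact saturated sets of $(L,\sigma(L))$, ordered by reverse inclusion, and $\sigma(L^{op})$ is ordered by inclusion.
   Context: $L^{op}$ is $L$ with the reversed order. For a poset $Q$: the upper topology $\upsilon(Q)$ is generated by the subbase $\{Q\setminus\mathord{\downarrow}x: x\in Q\}$, where $\mathord{\downarrow}x=\{y\in Q:y\le x\}$; the Scott topology $\sigma(Q)$ consists of the complements of those lower sets that are closed under existing suprema of directed subsets. A continuous lattice is a complete lattice that is a continuous poset. For two topologies on the same set, $\vee$ denotes the coarsest topology containing both. A subset $A$ of $L$ is saturated if $A=\mathord{\uparrow}A$ (it is an upper set of $L$). The empty set is counted as a compact saturated set. *)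

(* Defs.v *)
From HB Require Import structures.
From mathcomp Require Import all_boot all_order.
From mathcomp Require Import all_classical.
From mathcomp Require Import topology.

Set Implicit Arguments.
Unset Strict Implicit.
Unset Printing Implicit Defensive.

Local Open Scope classical_set_scope.
Local Open Scope order_scope.

Section Posets.
Context {d : Order.disp_t} {Q : porderType d}.
Implicit Types (A D : set Q) (x y z : Q).

Definition directed D :=
  D !=set0 /\ forall x y, D x -> D y -> exists z, [/\ D z, x <= z & y <= z].

Definition lower_set A := forall x y, A y -> x <= y -> A x.

Definition up_closure A : set Q := [set y | exists2 x, A x & x <= y].

Definition saturated A := A = up_closure A.

(* Least upper bounds are only required when they exist: [Q] is an arbitrary
   poset, and directed sets are nonempty. *)
Definition scott_closed A :=
  lower_set A /\
  forall D s, directed D -> D `<=` A -> supremums D s -> A s.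

Definition scott_open A := scott_closed (~` A).

Definition way_below x y :=
  forall D s, directed D -> supremums D s -> y <= s ->
  exists2 z, D z & x <= z.

End Posets.

Definition complete_lattice {d} (Q : porderType d) :=
  forall A : set Q, supremums A !=set0 /\ infimums A !=set0.

Definition continuous_poset {d} (Q : porderType d) :=
  forall x : Q, directed (way_below^~ x) /\ supremums (way_below^~ x) x.

Definition continuous_lattice {d} (Q : porderType d) :=
  complete_lattice Q /\ continuous_poset Q.

Definition scott_topology {d} (Q : porderType d) : Type := Q.

Section ScottTopology.
Context {d : Order.disp_t} (Q : porderType d).

Let scott_openT : @scott_open d Q setT.
Proof.
rewrite /scott_open setCT; split=> // D s [[x Dx] _] /(_ x Dx) [].
Qed.

Let scott_openI : setI_closed (@scott_open d Q).
Proof.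
move=> A B [lA dA] [lB dB]; rewrite /scott_open setCI; split.
  by move=> x y [Ay|By] xy; [left; exact: lA xy|right; exact: lB xy].
move=> D s dD DAB Ds; apply: contrapT => /not_orP[/contrapT As /contrapT Bs].
have [DA|/existsNP[x /not_implyP[Dx /contrapT Ax]]] := pselect (D `<=` ~` A).
  exact: dA DA Ds As.
have lub z : D z -> z <= s by move=> ?; exact: Ds.1.
pose E := D `&` [set z | x <= z].
have EB : E `<=` ~` B.
  move=> z [Dz xz]; have [nAz|//] := DAB z Dz.
  by have := lA _ _ nAz xz.
apply: (dB E s) => //.
  split; first by exists x; split=> //=.
  move=> u v [Du xu] [Dv xv]; have [w [Dw uw vw]] := dD.2 u v Du Dv.
  by exists w; split=> //; split=> //=; exact: Order.le_trans uw.
split=> [z [Dz _]|u Eu]; first exact: lub.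
apply: Ds.2 => z Dz; have [w [Dw zw xw]] := dD.2 z x Dz Dx.
by apply: Order.le_trans zw _; exact: Eu.
Qed.

Let scott_open_bigU (I : Type) (f : I -> set Q) :
  (forall i, scott_open (f i)) -> scott_open (\bigcup_i f i).
Proof.
move=> fo; rewrite /scott_open setC_bigcup; split.
  by move=> x y fy xy i _; apply: (fo i).1 xy; exact: fy.
by move=> D s dD Df Ds i _; apply: (fo i).2 dD _ Ds => x /Df; apply.
Qed.

HB.instance Definition _ := Choice.on (scott_topology Q).
HB.instance Definition _ := isOpenTopological.Build (scott_topology Q)
  scott_openT scott_openI scott_open_bigU.

End ScottTopology.

Definition upper_topology {d} (Q : porderType d) : Type := Q.

Section UpperTopology.
Context {d : Order.disp_t} (Q : porderType d).

Definition upper_subbase : set (set Q) :=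
  [set ~` [set y | y <= x] | x in [set: Q]].

HB.instance Definition _ := Choice.on (upper_topology Q).
HB.instance Definition _ :=
  isSubBaseTopological.Build (upper_topology Q) upper_subbase id.

End UpperTopology.

Arguments upper_subbase {d} Q.

Definition sigma {d} (Q : porderType d) : set (set Q) :=
  @open (scott_topology Q).

Definition upsilon {d} (Q : porderType d) : set (set Q) :=
  @open (upper_topology Q).

Arguments sigma {d} Q.
Arguments upsilon {d} Q.

(* The join of topologies is the library's [sup_topology]: its subbase is
   [sigma L `|` sigma L^d]. *)
Definition bi_scott_class {d} (L : porderType d) (b : bool) : Topological L :=
  if b then Topological.class (scott_topology L)
  else Topological.class (scott_topology L^d).

Definition bi_scott {d} (L : porderType d) : topologicalType :=
  sup_topology (bi_scott_class L).

Definition compact_saturated {d} (L : porderType d) : set (set L) :=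
  [set K : set L | compact (K : set (scott_topology L)) /\ saturated K].

Arguments compact_saturated {d} L.

(* Isomorphism of the subsets [A] and [B], ordered by the restrictions of
   [leA] and [leB]; the values of [f] outside [A] are irrelevant. *)
Definition order_isomorphic {T U : Type} (A : set T) (leA : T -> T -> Prop)
    (B : set U) (leB : U -> U -> Prop) :=
  exists2 f : T -> U, set_bij A B f &
    forall x y, A x -> A y -> (leA x y <-> leB (f x) (f y)).

(* Main.v *)
Require Import Defs.
From mathcomp Require Import all_boot all_order.
From mathcomp Require Import finmap.
From mathcomp Require Import all_classical.
From mathcomp Require Import topology.

(** Write [M] for the opposite of the continuous lattice [L].  The upper
    topology of [M] has the complements of the sets [up a] (the elements above
    [a], in the order of [L]) as a subbase and is always contained in the Scott
    topology of [M].  Everything rests on two facts about [L].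

    - Every ultrafilter [F] on [L] converges to the supremum of
      [{a | up a in F}], in the Scott topology of [L] and in the upper topology
      of [M] simultaneously ([ultrafilter_liminf]).  So the closed sets of the
      upper topology of [M] are Scott compact in [L], the Scott-closed sets of
      [L] are compact in the upper topology of [M], and the bi-Scott topology is
      compact as soon as the two topologies of [M] agree.
    - When [K] is compact saturated and [y] is not in [K], a Scott-open set and
      a finitely generated upper set can be inserted between [K] and the
      complement of the point [y] ([compact_saturated_separation]).

    Together they say that the compact saturated sets of [L] are exactly the
    complements of the opens of the upper topology of [M]
    ([compact_saturatedE]).  The bi-Scott topology is Hausdorff in any case.  If
    it is compact, each Scott-closed set of [M] is bi-Scott compact, hence Scott
    compact in [L], and complementation is the isomorphism asked for.

    The remaining implication starts from an arbitrary order isomorphism, which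
    amounts by complementation to one [f] from the Scott topology of [M] to its
    upper topology.  The two facts above make the upper topology of
    [M] core-compact, that is, a continuous lattice of opens.  This is an order
    property, so the Scott topology of [M] is core-compact as well.  For a
    complete lattice this forces the Scott topology to be sober, since the
    binary join of [M], the meet of [L], is then jointly continuous
    ([sigma_prime]).  Thus in
    both topologies the meet-prime opens are the complements of the sets
    [up x].  The isomorphism permutes them, which induces an order automorphism
    [phi] of [L] with [x \in U <-> phi x \in f U]; as [phi] is continuous for
    the upper topology, every Scott-open [U] is open in the upper topology. *)

Set Implicit Arguments.
Unset Strict Implicit.
Unset Printing Implicit Defensive.

Local Open Scope order_scope.
Local Open Scope classical_set_scope.

(** * Directed covers and limits *)

Definition directed_family {T : Type} (B : set (set T)) :=
  B !=set0 /\
  forall U V, B U -> B V -> exists W, [/\ B W, U `<=` W & V `<=` W].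

(** [compact_cover] in directed form.  It holds without a base point, which a
    bare poset does not come with. *)
Lemma compact_directed_cover {T : topologicalType} (K : set T)
    (B : set (set T)) :
  compact K -> directed_family B -> (forall U, B U -> open U) ->
  K `<=` \bigcup_(U in B) U -> exists2 U, B U & K `<=` U.
Proof.
move=> cK [B0 dB] oB KB; apply: contrapT => noU.
pose F := filter_from B (fun U => K `\` U).
have FF : ProperFilter F.
  apply: filter_from_proper.
    apply: filter_from_filter => // U V BU BV.
    have [W [BW UW VW]] := dB U V BU BV.
    by exists W => // x [Kx nWx]; do 2!split=> //; [move=> /UW|move=> /VW].
  move=> U BU; apply/set0P/negP => /eqP KU0; apply: noU; exists U => // x Kx.
  by apply: contrapT => nUx; rewrite -[False]/(set0 x) -KU0.
have FK : F K by have [U BU] := B0; exists U => // x [].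
have [p [Kp clp]] := cK F FF FK; have [U BU Up] := KB p Kp.
have FKU : F (K `\` U) by exists U.
by have [x [[_ nUx] /nUx]] := clp _ U FKU (open_nbhs_nbhs (conj (oB U BU) Up)).
Qed.

Lemma cvg_open {X : topologicalType} (F : set_system X) (p : X) :
  Filter F -> (forall U, open U -> U p -> F U) -> F --> p.
Proof.
move=> FF Fp A; rewrite nbhsE => -[U [oU Up] UA].
exact: filterS UA (Fp U oU Up).
Qed.

(** * The Scott and upper topologies of the opposite order *)

Lemma sigmaP {d : Order.disp_t} {L : porderType d} (U : set L) :
  sigma L U <->
  (forall x y, U x -> x <= y -> U y) /\
  (forall D x, directed D -> supremums D x -> U x -> exists2 z, D z & U z).
Proof.
split=> [[lU dU]|[lU dU]].
  split=> [x y Ux xy|D x fD iD Ux].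
    by apply: contrapT => nUy; have := lU x y nUy xy; exact.
  apply: contrapT => nD; apply: (dU D x) Ux => // z Dz Uz.
  by apply: nD; exists z.
split=> [x y nUy yx Ux|D x fD DU iD Ux]; first exact/nUy/(lU x y).
by have [z Dz] := dU D x fD iD Ux; exact: DU.
Qed.

Section Posets.
Context {d : Order.disp_t} {L : porderType d}.
Implicit Types (A D K U V : set L) (x y z : L) (s : seq L).

Definition filtered D :=
  D !=set0 /\ forall x y, D x -> D y -> exists z, [/\ D z, z <= x & z <= y].

Lemma sigma_dualP U : sigma L^d U <->
  (forall x y, U y -> x <= y -> U x) /\
  (forall D x, filtered D -> infimums D x -> U x -> exists2 z, D z & U z).
Proof.
split=> [/(@sigmaP _ L^d)[lU dU]|[lU dU]].
  by split=> // x y Uy xy; exact: lU Uy xy.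
by apply/(@sigmaP _ L^d); split=> // x y Ux yx; exact: lU Ux yx.
Qed.

Definition upset_of s : set L := [set z | exists2 a, a \in s & a <= z].

Lemma upset_of1 a : upset_of [:: a] = [set z | a <= z].
Proof.
apply/seteqP; split=> z [b]; first by rewrite inE => /eqP->.
by exists a; rewrite ?inE.
Qed.

Lemma upset_of_up s x y : upset_of s x -> x <= y -> upset_of s y.
Proof. by move=> [a sa ax] xy; exists a => //; exact: Order.le_trans xy. Qed.

Lemma upset_of_cat s t : upset_of (s ++ t) = upset_of s `|` upset_of t.
Proof.
apply/seteqP; split=> [z [a]|z [] [a sa az]].
- by rewrite mem_cat => /orP[sa az|ta az]; [left|right]; exists a.
- by exists a; rewrite // mem_cat sa.
- by exists a; rewrite // mem_cat sa orbT.
Qed.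

Lemma upsilonC_upset_of s : upsilon L^d (~` upset_of s).
Proof.
elim: s => [|a s IHs].
  rewrite (_ : ~` _ = setT); first exact: openT.
  by apply/seteqP; split=> // z _ [].
rewrite -cat1s upset_of_cat setCU; apply: openI => //.
rewrite upset_of1.
exists [set ~` [set z : L | a <= z]]; last by rewrite bigcup_set1.
move=> _ ->; exists [fset ~` [set z : L | a <= z]]%fset; last first.
  by rewrite set_fset1 bigcap_set1.
by move=> E /fset1P EE; rewrite inE; exists a => //; exact: esym EE.
Qed.

Lemma upsilonC_up a : upsilon L^d (~` [set z : L | a <= z]).
Proof. by rewrite -upset_of1; exact: upsilonC_upset_of. Qed.

(** The subbase generates the topology: a basic neighbourhood excludes the upper
    sets of finitely many points. *)
Lemma upsilonP U : upsilon L^d U <->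
  forall y, U y -> exists2 s, ~ upset_of s y & ~` upset_of s `<=` U.
Proof.
split=> [[B sB <-] y [C BC Cy]|nbU].
  have [D sD CE] := sB C BC.
  (* [c] names the generator of each of the finitely many subbasic sets. *)
  have /choice[c cP] (E : set L) :
      exists x, (E \in D) -> E = ~` [set z : L | x <= z].
    have [DE|nDE] := boolP (E \in D); last by exists y.
    have := sD E DE; rewrite inE => -[x _ xE]; exists x => _.
    by rewrite -xE.
  exists (map c (enum_fset D)).
    move=> [_ /mapP[E DE ->] cEy]; move: Cy; rewrite -CE => /(_ E DE).
    by rewrite (cP E DE); exact.
  move=> z nz; suff : C z by exists C.
  rewrite -CE => E DE; rewrite (cP E DE) => cEz.
  by apply: nz; exists (c E) => //; exact: map_f.
pose B := [set s | ~` upset_of s `<=` U].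
rewrite (_ : U = \bigcup_(s in B) ~` upset_of s).
  by apply: bigcup_open => s _; exact: upsilonC_upset_of.
apply/seteqP; split=> [y /nbU[s sy sU]|y [s sU sy]]; [by exists s|exact: sU].
Qed.

(** A filtered set contained in finitely many sets [up a] lies in one of them,
    so its infimum does too. *)
Lemma upsilon_sigma U : upsilon L^d U -> sigma L^d U.
Proof.
move=> /upsilonP nbU; apply/sigma_dualP; split=> [x y Uy xy|D x fD iD Ux].
  have [s sy] := nbU y Uy; apply=> sx; exact/sy/(upset_of_up sx).
have [s sx sU] := nbU x Ux; apply: contrapT => nD.
have Ds z : D z -> upset_of s z.
  by move=> Dz; apply: contrapT => /sU Uz; apply: nD; exists z.
suff [a sa aD] : exists2 a, a \in s & forall z, D z -> a <= z.
  by apply: sx; exists a => //; apply: iD.2.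
elim: s {sx sU} Ds => [|a s IHs] Ds.
  by have [[z Dz] _] := fD; have [] := Ds z Dz.
(* If [w] in [D] is not above [a], replace every [z] in [D] by an element below
   both [z] and [w]: it is not above [a] either, so [a] can be dropped. *)
have [aD|/existsNP[w /not_implyP[Dw naw]]] := pselect (forall z, D z -> a <= z).
  by exists a; rewrite ?inE ?eqxx.
have [|b sb bD] := IHs; last by exists b; rewrite // inE sb orbT.
move=> z Dz; have [u [Du uz uw]] := fD.2 z w Dz Dw.
have [b] := Ds u Du; rewrite inE => /orP[/eqP-> au|sb bu].
  by have := Order.le_trans au uw.
by exists b => //; exact: Order.le_trans uz.
Qed.

End Posets.

(** * Compactness in a complete lattice *)

Section CompleteLattice.
Context {d : Order.disp_t} {L : porderType d}.
Hypothesis complete_L : complete_lattice L.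
Implicit Types (C D K U V : set L) (x y z : L) (s : seq L).

(** The limit is the lower limit of the filter.  The set [I] of eventual lower
    bounds is directed, so a Scott-open set containing its supremum meets [I]
    and belongs to [F].  And [up a] can only belong to [F] if [a] is in [I],
    hence below the limit; maximality of [F] puts the complement of [up a] in
    [F] otherwise. *)
Lemma ultrafilter_liminf (F : set_system L) : UltraFilter F ->
  exists p, (forall U, sigma L U -> U p -> F U) /\
            (forall U, upsilon L^d U -> U p -> F U).
Proof.
move=> FU; pose I := [set a | F [set z : L | a <= z]].
have [[p [Ip lubp]] _] := complete_L I; exists p; split=> U.
  move=> /sigmaP[uU dU] Up; suff [a Ia Ua] : exists2 a, I a & U a.
    by apply: filterS Ia => z; exact: uU.
  apply: dU Up; last by split.
  split=> [|a b Ia Ib].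
    have [[b [_ lb]] _] := complete_L set0.
    by exists b; apply: filterS filterT => z _; apply: lb.
  have [[c [abc lubc]] _] := complete_L [set a; b].
  exists c; split; [|by apply: abc; left|by apply: abc; right].
  by apply: filterS (filterI Ia Ib) => z [az bz]; apply: lubc => w [] ->.
move=> /upsilonP nbU Up; have [s sp sU] := nbU p Up; apply: filterS sU _.
have Fs a : a \in s -> F (~` [set z : L | a <= z]).
  move=> sa; have [Fa|//] := in_ultra_setVsetC [set z : L | a <= z] FU.
  by exfalso; apply: sp; exists a => //; exact: Ip.
elim: s {sp} Fs => [|a s IHs] Fs.
  by apply: filterS filterT => z _ [].
rewrite -cat1s upset_of_cat setCU upset_of1; apply: filterI.
  by apply: Fs; rewrite inE eqxx.
by apply: IHs => b sb; apply: Fs; rewrite inE sb orbT.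
Qed.

(** Together with [upsilonC_compact], a duality between the Scott topology of [L]
    and the upper topology of its opposite: the closed sets of each are compact
    in the other. *)
Lemma scott_closed_compact C :
  sigma L (~` C) -> compact (C : set (upper_topology L^d)).
Proof.
move=> oC; rewrite compact_ultra => F FU FC.
have [p [Fp Fp']] := ultrafilter_liminf FU; exists p; split.
  apply: contrapT => /(Fp _ oC) FnC.
  by have [z [Cz]] := filter_ex (filterI FC FnC); exact.
exact: (@cvg_open (upper_topology L^d)).
Qed.

Lemma upsilonC_compact K :
  upsilon L^d (~` K) -> compact (K : set (scott_topology L)).
Proof.
move=> oK; rewrite compact_ultra => F FU FK.
have [p [Fp Fp']] := ultrafilter_liminf FU; exists p; split.
  apply: contrapT => /(Fp' _ oK) FnK.
  by have [z [Kz]] := filter_ex (filterI FK FnK); exact.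
exact: (@cvg_open (scott_topology L)).
Qed.

Lemma compact_bi_scott : sigma L^d = upsilon L^d -> compact [set: bi_scott L].
Proof.
move=> sigma_upsilon; rewrite compact_ultra => F FU _.
have [p [Fp Fp']] := ultrafilter_liminf FU; exists p; split=> //.
apply/cvg_sup => -[].
  exact: (@cvg_open (scott_topology L)).
apply: (@cvg_open (scott_topology L^d)) => U oU; apply: Fp'.
rewrite -sigma_upsilon; exact: oU.
Qed.

(** The set is [{y | meet x y \in W}], with membership of the meet in the lower
    set [W] expressed through the common lower bounds.  It is open because
    meets with a fixed [x] commute with infima. *)
Lemma sigma_dual_meet W x : sigma L^d W ->
  sigma L^d [set y | forall t, t <= x -> t <= y -> W t].
Proof.
move=> /sigma_dualP[lW dW]; apply/sigma_dualP; split=> [y z Wz yz t tx ty|].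
  exact/Wz/(Order.le_trans ty).
move=> D y [[z0 Dz0] fD] [Dy glby] Wy.
(* [E] is the filtered set of the meets of [x] with the elements of [D]. *)
pose E := [set m | exists2 z, D z & infimums [set x; z] m].
have [_ [e [Ee glbe]]] := complete_L E.
have lbE z m : infimums [set x; z] m -> m <= x /\ m <= z.
  by move=> [lm _]; split; apply: lm; [left|right].
have [m [z Dz izm] Wm] : exists2 m, E m & W m.
  apply: dW (conj Ee glbe) _.
    split=> [|m n [u Du ium] [v Dv ivn]].
      have [_ [m im]] := complete_L [set x; z0].
      by exists m; exists z0.
    have [w [Dw wu wv]] := fD u v Du Dv.
    have [_ [k ik]] := complete_L [set x; w]; exists k.
    have [kx kw] := lbE _ _ ik.
    split; first by exists w.
      by apply: ium.2 => t [] -> //; exact: Order.le_trans wu.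
    by apply: ivn.2 => t [] -> //; exact: Order.le_trans wv.
  apply: Wy.
    have [_ [m im]] := complete_L [set x; z0].
    have [mx _] := lbE _ _ im.
    by apply: Order.le_trans mx; apply: Ee; exists z0.
  apply: glby => z Dz; have [_ [m im]] := complete_L [set x; z].
  have [_ mz] := lbE _ _ im.
  by apply: Order.le_trans mz; apply: Ee; exists z.
by exists z => // t tx tz; apply: lW Wm _; apply: izm.2 => u [] ->.
Qed.

End CompleteLattice.

(** * Way-below sets and separation in a continuous poset *)

Section ContinuousPoset.
Context {d : Order.disp_t} {L : porderType d}.
Hypothesis continuous_L : continuous_poset L.
Implicit Types (K O : set L) (x y z : L) (s : seq L).

Lemma way_below_le x y : way_below x y -> x <= y.
Proof.
move=> xy; have [|||z ->] // := xy [set y] y; last by rewrite supremums1.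
by split=> [|u v -> ->]; [exists y|exists y].
Qed.

Lemma way_below_trans x y z : way_below x y -> y <= z -> way_below x z.
Proof.
by move=> xy yz D s dD Ds zs; apply: xy dD Ds (Order.le_trans yz zs).
Qed.

(** If [D] is directed with supremum [x], then so is the set [E] of all elements
    way below some member of [D]; hence [way_below a x] puts [a] under such an
    element. *)
Lemma sigma_way_below a : sigma L [set x | way_below a x].
Proof.
apply/sigmaP; split=> [x y|D x [[z0 Dz0] dD] [Dx lubx] ax].
  exact: way_below_trans.
pose E := [set b | exists2 z, D z & way_below b z].
have [|||b [z Dz bz] ab] // := ax E x.
- split=> [|u v [z Dz uz] [w Dw vw]].
    by have [[[b bz0] _] _] := continuous_L z0; exists b; exists z0.
  have [k [Dk zk wk]] := dD z w Dz Dw.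
  have [[_ dk] _] := continuous_L k.
  have [t [tk ut vt]] := dk u v (way_below_trans uz zk) (way_below_trans vw wk).
  by exists t; split=> //; exists k.
- split=> [b [z Dz /way_below_le bz]|u Eu].
    exact: Order.le_trans bz (Dx z Dz).
  apply: lubx => z Dz; have [_ [_ lubz]] := continuous_L z.
  by apply: lubz => b bz; apply: Eu; exists z.
exists z => // E' s dE' iE' zs; have [u Eu bu] := bz E' s dE' iE' zs.
by exists u => //; exact: Order.le_trans bu.
Qed.

(** Each [k] in [K] is the supremum of the elements way below it and is not
    below [y], so some [a] way below [k] is not below [y].  Finitely many such
    [a] suffice, by compactness. *)
Lemma compact_saturated_separation K y : compact_saturated L K -> ~ K y ->
  exists O s, [/\ sigma L O, K `<=` O, O `<=` upset_of s & ~ upset_of s y].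
Proof.
move=> [cK sK] nKy.
pose W s := [set x | exists2 a, a \in s & way_below a x].
pose B := [set O | exists2 s, ~ upset_of s y & O = W s].
have oW s : sigma L (W s).
  rewrite (_ : W s = \bigcup_(a in [set` s]) [set x | way_below a x]).
    by apply: (@bigcup_open (scott_topology L)) => a _; exact: sigma_way_below.
  by apply/seteqP; split=> x [a]; exists a.
have dB : directed_family B.
  split=> [|_ _ [s sy ->] [t ty ->]].
    by exists (W [::]); exists [::] => // -[].
  exists (W (s ++ t)); split.
  - by exists (s ++ t) => //; rewrite upset_of_cat => -[].
  - by move=> x [a sa ax]; exists a; rewrite // mem_cat sa.
  - by move=> x [a ta ax]; exists a; rewrite // mem_cat ta orbT.
have oB O : B O -> sigma L O by move=> [s _ ->]; exact: oW.
have KB : K `<=` \bigcup_(O in B) O.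
  move=> k Kk; have [_ [_ lubk]] := continuous_L k.
  have [a ak nay] : exists2 a, way_below a k & ~ a <= y.
    apply: contrapT => nay; apply: nKy; rewrite sK; exists k => //.
    by apply: lubk => a ak; apply: contrapT => ay; apply: nay; exists a.
  exists (W [:: a]); last by exists a; rewrite ?inE.
  by exists [:: a]; rewrite // upset_of1.
have [_ [s sy ->] KW] :=
  @compact_directed_cover (scott_topology L) K B cK dB oB KB.
by exists (W s), s; split=> // x [a sa /way_below_le ax]; exists a.
Qed.

End ContinuousPoset.

(** * Order isomorphisms between topologies *)

(** In the closed-set reading, the complement of a prime open is an irreducible
    closed set. *)
Definition prime_open {X : topologicalType} (P : set X) :=
  [/\ open P, P <> setT &
      forall U V, open U -> open V -> U `&` V `<=` P -> U `<=` P \/ V `<=` P].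

(** A Scott-open subset of the lattice of opens. *)
Definition scott_open_family {X : topologicalType} (N : set (set X)) :=
  [/\ forall U, N U -> open U,
      forall U V, N U -> open V -> U `<=` V -> N V &
      forall B, directed_family B -> (forall U, B U -> open U) ->
        N (\bigcup_(U in B) U) -> exists2 U, B U & N U].

(** The lattice of opens is continuous: [U] is way below [V], and [N] is a
    Scott-open family separating them.  Asking for [N] rather than for the
    way-below relation builds in the interpolation property. *)
Definition core_compact (X : topologicalType) :=
  forall (V : set X) x, open V -> V x -> exists U N,
    [/\ open U, U x, scott_open_family N, N V & forall G, N G -> U `<=` G].

Section OpenIso.
Context {X Y : topologicalType} (f : set X -> set Y).
Hypothesis f_bij : set_bij open open f.
Hypothesis f_mono : forall U V, open U -> open V -> (U `<=` V <-> f U `<=` f V).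

Lemma open_iso_open U : open U -> open (f U).
Proof. by case: f_bij => fo _ _; exact: fo. Qed.

Lemma open_iso_surj V : open V -> exists2 U, open U & f U = V.
Proof. by case: f_bij => _ _ fs /fs. Qed.

Lemma open_isoT : f setT = setT.
Proof.
have [U oU fU] := open_iso_surj openT; apply/seteqP; split=> //.
by rewrite -fU; apply/f_mono => //; exact: openT.
Qed.

(** Unions are the suprema of opens, hence preserved. *)
Lemma open_iso_bigcup (B : set (set X)) : (forall U, B U -> open U) ->
  f (\bigcup_(U in B) U) = \bigcup_(U in B) f U.
Proof.
move=> oB; have oU : open (\bigcup_(U in B) U) by exact: bigcup_open.
apply/seteqP; split=> [|y [U BU]]; last first.
  by move: y; apply/f_mono => //; [exact: oB|exact: bigcup_sup].
have [|W oW fW] := @open_iso_surj (\bigcup_(U in B) f U).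
  by apply: bigcup_open => U /oB; exact: open_iso_open.
rewrite -fW; apply/f_mono => // x [U BU Ux].
suff /(_ x Ux) : U `<=` W by [].
by apply/f_mono; [exact: oB|by []|rewrite fW; exact: bigcup_sup].
Qed.

(** Points are not transported by [f], so a point [x] of [V] is recovered from
    the union of all opens of [X] whose image is way below [f V]: that union is
    sent onto [f V], so it contains [V]. *)
Lemma core_compact_iso : core_compact Y -> core_compact X.
Proof.
move=> ccY V x oV Vx.
pose B := [set U | open U /\ exists N, [/\ scott_open_family N, N (f V) &
                                   forall G, N G -> f U `<=` G]].
have oB U : B U -> open U by case.
have : V `<=` \bigcup_(U in B) U.
  apply/f_mono; [by []|exact: bigcup_open|rewrite open_iso_bigcup// => y fVy].
  have [_ [N [/open_iso_surj[U oU <-] fUy sN NfV NU]]] :=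
    ccY (f V) y (open_iso_open oV) fVy.
  by exists U => //; split=> //; exists N.
move=> /(_ x Vx)[U [oU [N [[oN upN dN] NfV NU]]] Ux].
exists U, [set G | open G /\ N (f G)]; split=> //; last first.
  by move=> G [oG NfG]; apply/f_mono => //; exact: NU.
split=> [G []//|G H [oG NfG] oH GH|C [[G0 CG0] dC] oC [_ NfC]].
  split=> //; apply: upN NfG _ _; first exact: open_iso_open.
  exact/f_mono.
have [|||_ [G CG <-] NfG] := dN [set f G | G in C].
- split=> [|_ _ [G CG <-] [H CH <-]]; first by exists (f G0); exists G0.
  have [W [CW GW HW]] := dC G H CG CH.
  by exists (f W); split; [exists W|apply/f_mono => //; exact: oC
                                 |apply/f_mono => //; exact: oC].
- by move=> _ [G /oC oG <-]; exact: open_iso_open.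
- by rewrite bigcup_image -open_iso_bigcup.
by exists G => //; split=> //; exact: oC.
Qed.

Lemma prime_open_iso P : open P -> prime_open P <-> prime_open (f P).
Proof.
move=> oP; split=> [[_ PT prP]|[_ fPT prfP]].
  split=> [||_ _ /open_iso_surj[U oU <-] /open_iso_surj[V oV <-] fUV].
  - exact: open_iso_open.
  - move=> fPT; apply: PT; apply/seteqP; split=> //.
    by apply/f_mono => //; [exact: openT|rewrite fPT].
  - have UVP : U `&` V `<=` P.
      apply/f_mono => //; first exact: openI.
      have oUV : open (U `&` V) by exact: openI.
      move=> y fUVy; apply: fUV.
      split; move: y fUVy; apply/f_mono => //;
        by [exact: subIsetl|exact: subIsetr].
    by have [UP|VP] := prP U V oU oV UVP; [left|right]; apply/f_mono.
split=> // [PT|U V oU oV UVP]; first by apply: fPT; rewrite PT open_isoT.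
have fUV : f U `&` f V `<=` f P.
  have [|W oW fW] := @open_iso_surj (f U `&` f V).
    by apply: openI; exact: open_iso_open.
  rewrite -fW; apply/f_mono => // x Wx; apply: UVP.
  by split; move: x Wx; apply/f_mono => //; rewrite fW => y [].
have [fUP|fVP] := prfP _ _ (open_iso_open oU) (open_iso_open oV) fUV.
  by left; apply/f_mono.
by right; apply/f_mono.
Qed.

End OpenIso.

(** * Prime opens of the opposite lattice *)

Section PrimeOpens.
Context {d : Order.disp_t} {L : porderType d}.
Implicit Types (P : set L) (x : L).

Lemma sigma_prime_up x :
  prime_open (~` [set z : L | x <= z] : set (scott_topology L^d)).
Proof.
split=> [||U V oU oV UV].
- exact: (upsilon_sigma (upsilonC_up x)).
- move=> PT; suff : (~` [set z : L | x <= z]) x by apply; exact: Order.le_refl.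
  by rewrite PT.
have [lU _] := (@sigma_dualP _ L U).1 oU.
have [lV _] := (@sigma_dualP _ L V).1 oV.
have [Ux|nUx] := pselect (U x); last by left=> z Uz xz; exact/nUx/(lU x z).
right=> z Vz xz; apply: (UV x _ (Order.le_refl x)).
by split=> //; exact: (lV x z).
Qed.

Lemma upsilon_prime_up x :
  prime_open (~` [set z : L | x <= z] : set (upper_topology L^d)).
Proof.
have [_ PT prP] := sigma_prime_up x.
split=> // [|U V oU oV]; first exact: upsilonC_up.
by apply: prP; exact: upsilon_sigma.
Qed.

Hypothesis complete_L : complete_lattice L.

(** If [P] contains the complement of a finitely generated upper set, primality
    reduces the generators to a single one; the supremum of all such single
    generators then generates the complement of [P]. *)
Lemma upsilon_prime P : prime_open (P : set (upper_topology L^d)) ->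
  exists a, P = ~` [set z : L | a <= z].
Proof.
move=> [oP PT prP].
have prs s : ~` upset_of s `<=` P ->
    exists2 a, a \in s & ~` [set z : L | a <= z] `<=` P.
  elim: s => [sP|a s IHs].
    by exfalso; apply: PT; apply/seteqP; split=> // z _; apply: sP => -[].
  rewrite -cat1s upset_of_cat setCU upset_of1.
  move=> /(prP _ _ (upsilonC_up a) (upsilonC_upset_of s))[aP|/IHs[b sb bP]].
    by exists a; rewrite ?inE ?eqxx.
  by exists b; rewrite // inE sb orbT.
pose I := [set b | ~` [set z : L | b <= z] `<=` P].
have [[a [Ia luba]] _] := complete_L I; exists a.
apply/seteqP; split=> [z Pz az|z naz].
  have [s sz /prs[b sb bP]] := (@upsilonP _ L P).1 oP z Pz.
  by apply: sz; exists b => //; apply: Order.le_trans (Ia b bP) az.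
apply: contrapT => nPz; apply: naz; apply: luba => b bP.
by apply: contrapT => nbz; apply: nPz; exact: bP.
Qed.

(** It suffices that the complement of [P] is filtered, for it then contains its
    infimum.  If [x] and [y] outside [P] had their meet in [P], core-compactness
    would give opens [O] around [x] and [U] around [y] with all meets of
    elements of [O] and [U] in [P]; as [w] is the meet of [w] and [w], the
    intersection of [O] and [U] is contained in [P], against primality. *)
Lemma sigma_prime P : core_compact (scott_topology L^d) ->
  prime_open (P : set (scott_topology L^d)) ->
  exists a, P = ~` [set z : L | a <= z].
Proof.
move=> ccL [oP PT prP]; have [lP dP] := (@sigma_dualP _ L P).1 oP.
(* [W x] is the set of the [y] whose meet with [x] is in [P]. *)
pose W x := [set y | forall t, t <= x -> t <= y -> P t].
have oW x : sigma L^d (W x) by exact: sigma_dual_meet.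
have WS x y : W x y -> W y x by move=> Wxy t ty tx; exact: Wxy.
have leW x y : x <= y -> W y `<=` W x.
  by move=> xy z Wyz t tx; apply: Wyz; exact: Order.le_trans xy.
have fP : filtered (~` P).
  split.
    by apply/set0P/negP => /eqP nP0; apply: PT; rewrite -[P]setCK nP0 setC0.
  move=> x y nPx nPy; apply: contrapT => nxy.
  have Wxy : W x y.
    move=> t tx ty; apply: contrapT => nPt; apply: nxy.
    by exists t.
  have [U [N [oU Uy [oN upN dN] NWx NU]]] := ccL _ y (oW x) Wxy.
  (* [W] turns filtered infima into directed unions, and [N] is Scott open. *)
  have oO : sigma L^d [set x' | N (W x')].
    apply/sigma_dualP; split=> [u v NWv uv|D e [[z0 Dz0] fD] ie NWe].
      by apply: upN NWv (oW u) _; exact: leW.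
    have [|||_ [z Dz <-] NWz] := dN [set W z | z in D]; last by exists z.
    - split=> [|_ _ [u Du <-] [v Dv <-]]; first by exists (W z0); exists z0.
      have [w [Dw wu wv]] := fD u v Du Dv.
      by exists (W w); split; [exists w|exact: leW|exact: leW].
    - by move=> _ [z _ <-]; exact: oW.
    apply: upN NWe _ _; first by apply: bigcup_open => _ [z _ <-]; exact: oW.
    move=> w /WS Wwe; have [_ dW] := (@sigma_dualP _ L _).1 (oW w).
    have [|z Dz Wwz] := dW D e _ ie Wwe; first by split=> //; exists z0.
    by exists (W z); [exists z|exact: WS].
  have [|OP|UP] := prP _ U oO oU.
  - by move=> w [NWw Uw]; exact: (NU _ NWw w Uw).
  - exact/nPx/OP.
  - exact/nPy/UP.
have [_ [a ia]] := complete_L (~` P).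
have nPa : ~ P a by move=> /(dP _ a fP ia)[z].
exists a; apply/seteqP; split=> [z Pz az|z naz]; first exact/nPa/(lP a z).
by apply: contrapT => nPz; apply: naz; exact: ia.1.
Qed.

(** The isomorphism [f] sends the prime open [~` up x] to [~` up (phi x)] and
    every [~` up a] is the image of [~` up (psi a)], so [phi] and [psi] form an
    adjunction.  A point [x] is in [U] exactly when [U] is not contained in
    [~` up x]; hence [U] is the preimage of [f U] under [phi]. *)
Lemma sigma_eq_upsilon_of_iso :
  core_compact (upper_topology L^d) ->
  order_isomorphic (sigma L^d) (fun U V => U `<=` V)
    (upsilon L^d) (fun U V => U `<=` V) ->
  sigma L^d = upsilon L^d.
Proof.
move=> ccU [f f_bij f_mono].
pose X := scott_topology L^d : topologicalType.
pose Y := upper_topology L^d : topologicalType.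
have ccS : core_compact X := @core_compact_iso X Y f f_bij f_mono ccU.
have oup x : sigma L^d (~` [set z : L | x <= z]).
  exact: (upsilon_sigma (upsilonC_up x)).
have prf (P : set L) : sigma L^d P ->
    prime_open (P : set X) <-> prime_open (f P : set Y).
  exact: (@prime_open_iso X Y f f_bij f_mono).
have /choice[phi phiE] (x : L) :
    exists y : L, f (~` [set z : L | x <= z]) = ~` [set z : L | y <= z].
  exact/upsilon_prime/prf/sigma_prime_up.
have /choice[psi psiE] (a : L) :
    exists y : L, f (~` [set z : L | y <= z]) = ~` [set z : L | a <= z].
  have [P oP fP] := @open_iso_surj X Y f f_bij _ (upsilonC_up a).
  have [|b bE] := @sigma_prime P ccS; last by exists b; rewrite -bE.
  by apply/prf => //; rewrite fP; exact: upsilon_prime_up.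
have subC (a b : L) :
    ~` [set z : L | a <= z] `<=` ~` [set z : L | b <= z] <-> a <= b.
  split=> [ab|ab z naz bz]; last exact: naz (Order.le_trans ab bz).
  by apply: contrapT => nab; exact: (ab b nab (Order.le_refl b)).
have adj (a x : L) : a <= phi x <-> psi a <= x.
  have := f_mono _ _ (oup (psi a)) (oup x); rewrite (phiE x) psiE => fax.
  by split=> /subC/fax/subC.
have fE (U : set L) (x : L) : sigma L^d U -> U x <-> f U (phi x).
  move=> oU; have lowerE (V : set L) y : sigma L^d V ->
      V y <-> ~ (V `<=` ~` [set z : L | y <= z]).
    move=> /sigma_dualP[lV _]; split=> [Vy /(_ y Vy)|].
      by apply; exact: Order.le_refl.
    move=> nV; apply: contrapT => nVy; apply: nV => z Vz yz.
    exact/nVy/(lV y z).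
  rewrite lowerE// f_mono// phiE -lowerE//.
  apply: upsilon_sigma; exact: (@open_iso_open X Y f f_bij).
apply/seteqP; split=> U; last exact: upsilon_sigma.
move=> oU; apply/upsilonP => x /fE -/(_ oU) fUx.
have /upsilonP nbfU : upsilon L^d (f U) by exact: (@open_iso_open X Y f f_bij).
have [s sx sU] := nbfU _ fUx; exists (map psi s).
  by move=> [_ /mapP[a sa ->] /adj ax]; apply: sx; exists a.
move=> z nz; apply/fE => //; apply: sU => -[a sa /adj az].
by apply: nz; exists (psi a) => //; exact: map_f.
Qed.

End PrimeOpens.

(** * Continuous lattices *)

Section ContinuousLattices.
Context {d : Order.disp_t} {L : porderType d}.
Hypothesis continuous_L : continuous_lattice L.
Let complete_L : complete_lattice L := continuous_L.1.
Let cont_L : continuous_poset L := continuous_L.2.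

(** By separation a compact saturated set is an intersection of finitely
    generated upper sets. *)
Lemma compact_saturatedE (K : set L) :
  compact_saturated L K <-> upsilon L^d (~` K).
Proof.
split=> [cK|oK].
  apply/upsilonP => y nKy.
  have [O [s [_ KO Os sy]]] := compact_saturated_separation cont_L cK nKy.
  by exists s => // z nsz /KO/Os.
split; first exact: upsilonC_compact.
have [lK _] := (@sigma_dualP _ L _).1 (upsilon_sigma oK).
apply/seteqP; split=> [x Kx|y [x Kx xy]]; first by exists x.
by apply: contrapT => nKy; exact: (lK x y).
Qed.

(** The upper topology of the opposite is locally compact, which is more than
    core-compact: between an open set and a smaller one around a given point
    lies the Scott-closed set [~` O], which is compact for it. *)
Lemma upsilon_core_compact : core_compact (upper_topology L^d).
Proof.
move=> V y oV Vy.
have [||O [s [oO KO Os sy]]] :=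
  @compact_saturated_separation _ _ cont_L (~` V) y.
- by apply/compact_saturatedE; rewrite setCK.
- exact.
exists (~` upset_of s), [set G | upsilon L^d G /\ ~` O `<=` G]; split=> //.
- exact: upsilonC_upset_of.
- split=> [G []//|G H [_ OG] oH GH|B dB oB [_ OB]].
    by split=> // z /OG/GH.
  have cO : compact (~` O : set (upper_topology L^d)).
    by apply: scott_closed_compact; rewrite ?setCK.
  have [G BG OG] := compact_directed_cover cO dB oB OB.
  by exists G => //; split=> //; exact: oB.
- by split=> // z nOz; apply: contrapT => /KO.
- by move=> G [_ OG] z nsz; apply: OG => /Os.
Qed.

Lemma bi_scott_open (U : set L) :
  sigma L U \/ sigma L^d U -> open (U : set (bi_scott L)).
Proof.
move=> oU; rewrite openE => x Ux.
have /cvg_sup cvgx : nbhs (x : bi_scott L) --> (x : bi_scott L) by [].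
case: oU => oU.
  exact: (cvgx true U (@open_nbhs_nbhs (scott_topology L) _ _ (conj oU Ux))).
exact: (cvgx false U (@open_nbhs_nbhs (scott_topology L^d) _ _ (conj oU Ux))).
Qed.

(** If [x] is not below [y], some [a] way below [x] is not below [y].  The set
    of elements that [a] is way below contains [x] and is disjoint from the
    complement of [up a], which contains [y]. *)
Lemma hausdorff_bi_scott : hausdorff_space (bi_scott L).
Proof.
suff sep (x y : L) : ~ x <= y -> exists U V,
    [/\ open (U : set (bi_scott L)), open (V : set (bi_scott L)),
        U x, V y & U `&` V = set0].
  move=> x y clxy; apply: contrapT => nxy.
  have [xy|/sep[U [V [oU oV Ux Vy UV0]]]] := pselect ((x : L) <= y).
    have /sep[U [V [oU oV Uy Vx UV0]]] : ~ (y : L) <= x.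
      by move=> yx; apply: nxy; apply: Order.le_anti; rewrite xy.
    have [z [Vz Uz]] := clxy V U (open_nbhs_nbhs (conj oV Vx))
                             (open_nbhs_nbhs (conj oU Uy)).
    by rewrite -[False]/(set0 z) -UV0.
  have [z [Uz Vz]] := clxy U V (open_nbhs_nbhs (conj oU Ux))
                           (open_nbhs_nbhs (conj oV Vy)).
  by rewrite -[False]/(set0 z) -UV0.
move=> nxy; have [_ [_ lubx]] := cont_L x.
have [a ax nay] : exists2 a, way_below a x & ~ a <= y.
  apply: contrapT => na; apply: nxy; apply: lubx => a ax.
  by apply: contrapT => nay; apply: na; exists a.
exists [set z | way_below a z], (~` [set z | a <= z]); split=> //.
- by apply: bi_scott_open; left; exact: sigma_way_below.
- by apply: bi_scott_open; right; exact: (upsilon_sigma (upsilonC_up a)).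
- by apply/seteqP; split=> // z [/way_below_le].
Qed.

Lemma compact_sigmaC (K : set L) :
  compact [set: bi_scott L] -> sigma L^d (~` K) ->
  compact (K : set (scott_topology L)).
Proof.
move=> cL oK; have cK : compact (K : set (bi_scott L)).
  apply: subclosed_compact cL _ => //; rewrite -[K]setCK; apply: open_closedC.
  by apply: bi_scott_open; right.
rewrite compact_ultra => F FU FK; move: cK; rewrite compact_ultra.
by move=> /(_ F FU FK)[p [Kp /cvg_sup/(_ true) Fp]]; exists p.
Qed.

End ContinuousLattices.

Theorem proposition4p4 (d : Order.disp_t) (L : porderType d)
    (L_continuous : continuous_lattice L) :
  [<-> sigma L^d = upsilon L^d;
       compact [set: bi_scott L] /\ hausdorff_space (bi_scott L);
       order_isomorphic (sigma L^d) (fun U V => U `<=` V)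
         (compact_saturated L) (fun K M => M `<=` K)].
Proof.
split; last split.
- move=> sigma_upsilon; split; last exact: hausdorff_bi_scott.
  exact: compact_bi_scott L_continuous.1 sigma_upsilon.
- move=> [cL _].
  have sigmaE U : sigma L^d U <-> compact_saturated L (~` U).
    split=> [oU|/(compact_saturatedE L_continuous)]; last first.
      by rewrite setCK; exact: upsilon_sigma.
    split; first by apply: compact_sigmaC; rewrite ?setCK.
    have [lU _] := (@sigma_dualP _ L U).1 oU.
    apply/seteqP; split=> [x nUx|y [x nUx xy] Uy]; first by exists x.
    exact/nUx/(lU x y).
  exists setC; last by move=> U V _ _; rewrite subsetCP.
  split=> [U /sigmaE//|U V _ _ /(congr1 setC)|K cK]; first by rewrite !setCK.
  by exists (~` K); rewrite /= ?setCK //; apply/sigmaE; rewrite setCK.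
- move=> [f [fK f_inj f_surj] f_mono].
  apply: sigma_eq_upsilon_of_iso L_continuous.1
    (upsilon_core_compact L_continuous) _.
  exists (fun U => ~` f U); last first.
    move=> U V oU oV; rewrite subsetCP; exact: f_mono.
  split=> [U oU|U V oU oV /(congr1 setC)|V oV].
  + by apply/(compact_saturatedE L_continuous)/fK.
  + by rewrite !setCK; exact: f_inj.
  + have [|U oU fU] := f_surj (~` V).
      by apply/(compact_saturatedE L_continuous); rewrite setCK.
    by exists U; rewrite // fU setCK.
Qed.
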